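(* Let $m\ge 2$ and let $\mu_1,\ldots,\mu_m$ be positive integers with $n=\sum_{i=1}^m\mu_i$. Define $$\Upsilon=\frac{n^2-n}{\sum_{i=1}^m\mu_i^2-n},$$ with the convention $\Upsilon=\infty$ when $\mu_1=\cdots=\mu_m=1$. Then for every integer $k\ge m$: if $k<\Upsilon$, the uniform distribution $U_k=(1/k,\ldots,1/k)$ is a local maximum of the function $\beta_k:\Pi_{[k]}\to[0,1]$, and if $k>\Upsilon$, $U_k$ is a local minimum of $\beta_k$.
   Context: For a positive integer $k$, $[k]=\{1,\ldots,k\}$ and $\Pi_{[k]}=\{\mathbf p=(p_1,\ldots,p_k): p_i\ge 0,\ \sum_i p_i=1\}$ is the probability simplex. The quantity $(\mu_1,\ldots,\mu_m)$ is the list of multiplicities of a pattern (the sequence obtained from a length-$n$ sequence by replacing each symbol by the order of its first occurrence; symbol $i$ appears $\mu_i$ times). For $\mathbf p\in\Pi_{[k]}$ with $k\ge m$, the pattern probability is $$\beta_k(\mathbf p)=P(\psi;\mathbf p)=\sum_{\sigma}\prod_{i=1}^m p_{\sigma(i)}^{\mu_i},$$ where the sum is over all one-to-one maps $\sigma:[m]\to[k]$. Local maximum/minimum are meant relative to $\Pi_{[k]}$, i.e. compared with all points of $\Pi_{[k]}$ in a neighbourhood of $U_k$. *)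

(* Defs.v *)
From HB Require Import structures.
From mathcomp Require Import all_boot all_order all_algebra.
From mathcomp Require Import all_classical all_reals all_analysis.
Set Implicit Arguments.
Unset Strict Implicit.
Unset Printing Implicit Defensive.
Import Order.TTheory GRing.Theory Num.Theory.
Import numFieldNormedType.Exports.

Local Open Scope classical_set_scope.
Local Open Scope ring_scope.

Definition simplex (R : realType) (k : nat) : set 'rV[R]_k :=
  [set p | (forall i, 0 <= p ord0 i) /\ \sum_(i < k) p ord0 i = 1].

Definition uniform_distr (R : realType) (k : nat) : 'rV[R]_k :=
  \row_(i < k) k%:R^-1.

(* [mu i] is the multiplicity of the [i]-th symbol of the pattern. The formula
   makes sense on the whole of R^k; it is the pattern probability when [p] lies
   in the simplex. *)
Definition pattern_prob (R : realType) (m k : nat) (mu : 'I_m -> nat)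
    (p : 'rV[R]_k) : R :=
  \sum_(s : {ffun 'I_m -> 'I_k} | injectiveb s)
    \prod_(i < m) p ord0 (s i) ^+ mu i.

Definition pattern_length (m : nat) (mu : 'I_m -> nat) : nat :=
  (\sum_(i < m) mu i)%N.

(* The denominator vanishes exactly when all multiplicities are 1. It is
   computed in [R], so no subtraction is truncated. *)
Definition Upsilon (R : realType) (m : nat) (mu : 'I_m -> nat) : \bar R :=
  let n : R := (pattern_length mu)%:R in
  if [forall i, mu i == 1%N] then +oo%E
  else ((n ^+ 2 - n) / (\sum_(i < m) (mu i)%:R ^+ 2 - n))%:E.

(* Non-strict local extrema relative to a subset [A]: [x] is only compared with
   the points of [A] that are close to it. *)
Definition local_max_on (R : realType) (T : topologicalType) (A : set T)
    (f : T -> R) (x : T) : Prop :=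
  A x /\ \forall y \near within A (nbhs x), f y <= f x.

Definition local_min_on (R : realType) (T : topologicalType) (A : set T)
    (f : T -> R) (x : T) : Prop :=
  A x /\ \forall y \near within A (nbhs x), f x <= f y.

(* Main.v *)
(* Write p_j = (1 + e_j)/k with sum_j e_j = 0, and put S = sum_j e_j^2,
   Q = sum_i mu_i^2. To second order the product over i of
   (1 + e_{s i})^{mu_i} is 1 + A + (A^2 - B)/2 with A = sum_i mu_i e_{s i} and
   B = sum_i mu_i e_{s i}^2. For s uniform among the injections, the pair
   (s i, s j) is uniform on the pairs of distinct symbols, so A has mean 0 and
   (A^2 - B)/2 has mean S D / (2k(k-1)) with D = k(Q - n) - (n^2 - n). The
   remainder is O(S^(3/2)), so near U_k the sign of the increment is that of D,
   and D > 0 exactly when k > Upsilon. *)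

Require Import Defs.
From HB Require Import structures.
From mathcomp Require Import all_boot all_order all_algebra.
From mathcomp Require Import all_fingroup.
From mathcomp Require Import all_classical all_reals all_analysis.
From mathcomp Require Import ring lra.
Set Implicit Arguments.
Unset Strict Implicit.
Unset Printing Implicit Defensive.
Import Order.TTheory GRing.Theory Num.Theory.
Import numFieldNormedType.Exports.
Local Open Scope classical_set_scope.
Local Open Scope ring_scope.

(** * Second-order expansion of products with a uniform cubic remainder *)

(** Here [b] is the second elementary symmetric polynomial of [s]. The bounds on [a] and [b] carry
    the induction: prepending x turns [b] into b + x a and a remainder r into (1 + x) r + x b. *)
Lemma prod_1D_taylor2 (R : realType) (t : nat) :
  exists2 C : R, 0 <= C & forall (s : seq R) (M : R), size s = t ->
    0 <= M <= 1 -> {in s, forall x, `|x| <= M} ->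
  let a := \sum_(x <- s) x in
  let b := (a ^+ 2 - \sum_(x <- s) x ^+ 2) / 2 in
  [/\ `|a| <= C * M, `|b| <= C * M ^+ 2 &
      `|\prod_(x <- s) (1 + x) - (1 + a + b)| <= C * M ^+ 3].
Proof.
elim: t => [|t [C C0 IH]].
  exists 0 => // s M /size0nil -> /andP[M0 M1] _ /=; rewrite !big_nil !mul0r.
  by rewrite expr0n /= subr0 mul0r !addr0 subrr normr0.
(* The three bounds for [x :: s] come out with constants C + 1, 2C and 3C, the last one because |1 +
   x| <= 2; 3C + 1 dominates them all. *)
exists (3 * C + 1); first by lra.
case=> // x s M /= [st] /andP[M0 M1] sM.
have /= := IH s M st; rewrite M0 M1 => /(_ isT).
have sM' : {in s, forall y, `|y| <= M}.
  by move=> y ys; apply: sM; rewrite inE ys orbT.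
move=> /(_ sM'); rewrite !big_cons.
set a := \sum_(x <- s) x; set q := \sum_(x <- s) x ^+ 2.
set P := \prod_(x <- s) _; set b := (a ^+ 2 - q) / 2 => -[aC bC PC].
have xM : `|x| <= M by apply: sM; rewrite inE eqxx.
have -> : ((x + a) ^+ 2 - (x ^+ 2 + q)) / 2 = b + x * a by rewrite /b; field.
have -> : (1 + x) * P - (1 + (x + a) + (b + x * a))
    = (1 + x) * (P - (1 + a + b)) + x * b by ring.
clearbody P b.
have M20 : 0 <= M ^+ 2 by rewrite exprn_ge0.
have M30 : 0 <= M ^+ 3 by rewrite exprn_ge0.
have CM0 : 0 <= C * M by rewrite mulr_ge0.
have CM20 : 0 <= C * M ^+ 2 by rewrite mulr_ge0.
have CM30 : 0 <= C * M ^+ 3 by rewrite mulr_ge0.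
rewrite !(mulrDl (3 * C)) !mul1r -!mulrA.
split.
- by apply: (le_trans (ler_normD _ _)); lra.
- apply: (le_trans (ler_normD _ _)); rewrite normrM.
  have : `|x| * `|a| <= M * (C * M) by apply: ler_pM.
  by rewrite (_ : M * (C * M) = C * M ^+ 2); [move=> ?; lra | ring].
- apply: (le_trans (ler_normD _ _)); rewrite !normrM.
  have : `|x| * `|b| <= M * (C * M ^+ 2) by apply: ler_pM.
  have x2 : `|1 + x| <= 2 by apply: (le_trans (ler_normD _ _)); rewrite normr1; lra.
  have : `|1 + x| * `|P - (1 + a + b)| <= 2 * (C * M ^+ 3) by apply: ler_pM.
  by rewrite (_ : M * (C * M ^+ 2) = C * M ^+ 3); [move=> ?; lra | ring].
Qed.

(** Repeating each [f i] exactly [mu i] times turns powers and weighted sums into a plain product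
    and plain sums over a list. Its length depends on [mu] alone, hence so does [C]. *)
Lemma prod_1D_exp_taylor2 (R : realType) (m : nat) (mu : 'I_m -> nat) :
  exists2 C : R, 0 <= C & forall (f : 'I_m -> R) (M : R),
    0 <= M <= 1 -> (forall i, `|f i| <= M) ->
  let a := \sum_(i < m) (mu i)%:R * f i in
  let q := \sum_(i < m) (mu i)%:R * f i ^+ 2 in
  `|\prod_(i < m) (1 + f i) ^+ mu i - (1 + a + (a ^+ 2 - q) / 2)|
    <= C * M ^+ 3.
Proof.
have [C C0 HC] := prod_1D_taylor2 R (\sum_(i < m) mu i).
exists C => // f M M01 fM.
pose s := flatten [seq nseq (mu i) (f i) | i <- index_enum 'I_m].
have st : size s = (\sum_(i < m) mu i)%N.
  rewrite size_flatten sumnE /shape -map_comp big_map.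
  by apply: eq_bigr => i _ /=; rewrite size_nseq.
have sM : {in s, forall x, `|x| <= M}.
  by move=> x /flatten_mapP[i _]; rewrite mem_nseq => /andP[_ /eqP->].
have [_ _] := HC s M st M01 sM.
have sumE (g : R -> R) :
    \sum_(x <- s) g x = \sum_(i < m) (mu i)%:R * g (f i).
  rewrite big_flatten big_map; apply: eq_bigr => i _.
  by rewrite big_nseq iter_addr_0 mulr_natl.
rewrite (sumE id) sumE big_flatten big_map /=.
by under eq_bigr => i _ do rewrite big_nseq iter_mulr_1.
Qed.

(** * Equidistribution of two values of an injection *)

Lemma perm_pair_transitive (T : finType) (a b a' b' : T) :
  a != b -> a' != b' -> exists t : {perm T}, t a = a' /\ t b = b'.
Proof.
(* The first transposition sends a to a' and b to b1; the second sends b1 to b' and fixes a', which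
   differs from both b1 and b'. *)
move=> ab ab'; set b1 := tperm a a' b.
exists (tperm a a' * tperm b1 b')%g; rewrite !permM tpermL -/b1 tpermL.
split=> //; rewrite tpermD // 1?eq_sym // /b1 -[X in X != _](tpermL a a').
by rewrite (inj_eq perm_inj).
Qed.

(** Composing with a permutation of [T] that carries (a, b) to (a', b') maps one fibre bijectively
    onto the other. *)
Lemma card_inj_pair_fiber (I T : finType) (i j : I) (a b a' b' : T) :
  a != b -> a' != b' ->
  #|[pred s : {ffun I -> T} | injectiveb s && ((s i == a) && (s j == b))]| =
  #|[pred s : {ffun I -> T} | injectiveb s && ((s i == a') && (s j == b'))]|.
Proof.
move=> ab ab'; have [t [<- <-]] := perm_pair_transitive ab ab'.
pose h (s : {ffun I -> T}) := [ffun x => t (s x)].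
have hI : injective h.
  move=> s1 s2 /ffunP e; apply/ffunP => x; move: (e x); rewrite !ffunE.
  exact: perm_inj.
rewrite -!sum1_card [RHS](reindex_inj hI); apply: eq_bigl => s.
rewrite !inE !ffunE !(inj_eq perm_inj); congr (_ && _).
apply/injectiveP/injectiveP => sI x y.
  by rewrite !ffunE => /perm_inj /sI.
by move=> e; apply: sI; rewrite !ffunE e.
Qed.

(** Group the injections by the pair (s i, s j): all fibres over off-diagonal pairs have the same
    size, which is eliminated by taking the constant function 1 for [F]. Clearing denominators keeps
    the identity valid when [T] has fewer than two elements. *)
Lemma sum_inj_pair (R : realType) (I T : finType) (i j : I)
    (F : T -> T -> R) : i != j ->
  (#|T| * #|T|.-1)%:R * \sum_(s : {ffun I -> T} | injectiveb s) F (s i) (s j)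
  = #|[pred s : {ffun I -> T} | injectiveb s]|%:R
    * \sum_a \sum_(b | b != a) F a b.
Proof.
move=> ij.
pose N a b :=
  #|[pred s : {ffun I -> T} | injectiveb s && ((s i == a) && (s j == b))]|.
have sumN (G : T -> T -> R) :
    \sum_(s : {ffun I -> T} | injectiveb s) G (s i) (s j)
    = \sum_a \sum_(b | b != a) G a b * (N a b)%:R.
  rewrite (partition_big (fun s : {ffun I -> T} => s i) predT) //=.
  apply: eq_bigr => a _.
  rewrite (partition_big (fun s : {ffun I -> T} => s j) (fun b => b != a)).
    apply: eq_bigr => b _.
    transitivity (\sum_(s : {ffun I -> T} |
        injectiveb s && ((s i == a) && (s j == b))) G a b).
      by apply: eq_big => [s|s /andP[/andP[_ /eqP-> /eqP->//]]]; rewrite andbA.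
    by rewrite sumr_const mulr_natr.
  move=> s /andP[/injectiveP sI /eqP <-].
  by rewrite (inj_eq sI) eq_sym.
have cardE : #|[pred s : {ffun I -> T} | injectiveb s]|%:R
    = \sum_(a : T) \sum_(b | b != a) (N a b)%:R :> R.
  rewrite -sum1_card natr_sum (sumN (fun _ _ => 1)).
  by do 2![apply: eq_bigr => ? _]; rewrite mul1r.
rewrite sumN cardE.
have cardC a : (#|T|.-1 = \sum_(b : T | b != a) 1)%N.
  by rewrite sum1_card (cardD1 a T) inE /=; apply: eq_card => b; rewrite !inE andbT.
have [[a0 b0] /= ab0|noab] := pickP [pred ab : T * T | ab.1 != ab.2].
  have NE a b : b != a -> N a b = N a0 b0.
    by rewrite eq_sym => ab; apply: card_inj_pair_fiber.
  have sumE (G : T -> T -> R) : \sum_a \sum_(b | b != a) G a b * (N a b)%:R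
      = (\sum_a \sum_(b | b != a) G a b) * (N a0 b0)%:R.
    rewrite mulr_suml; apply: eq_bigr => a _; rewrite mulr_suml.
    by apply: eq_bigr => b /NE ->.
  have -> : \sum_(a : T) \sum_(b | b != a) (N a b)%:R
      = (\sum_(a : T) \sum_(b | b != a) 1) * (N a0 b0)%:R :> R.
    by rewrite -sumE; do 2![apply: eq_bigr => ? _]; rewrite mul1r.
  rewrite sumE.
  have -> : \sum_(a : T) \sum_(b | b != a) 1 = (#|T| * #|T|.-1)%:R :> R.
    rewrite -sum_nat_const natr_sum; apply: eq_bigr => a _.
    by rewrite (cardC a) natr_sum.
  by ring.
(* Without two distinct points every off-diagonal sum is empty, and both sides vanish. *)
have sum0 (G : T -> T -> R) : \sum_a \sum_(b | b != a) G a b = 0.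
  apply: big1 => a _; apply: big1 => b.
  by have /= := noab (b, a) => ->.
by rewrite !sum0 mulr0 mul0r.
Qed.

(** * First and second moments over the injections *)

Section InjectionMoments.
Variables (R : realType) (m k : nat) (e : 'I_k -> R).
Hypotheses (m2 : (2 <= m)%N) (k0 : (0 < k)%N) (e0 : \sum_a e a = 0).

Let N : R := #|[pred s : {ffun 'I_m -> 'I_k} | injectiveb s]|%:R.
Let K : R := (k * k.-1)%:R.
Let S : R := \sum_a e a ^+ 2.

Lemma exists_neq_ord (i : 'I_m) : exists j, i != j.
Proof.
have m0 : (0 < m)%N by apply: leq_trans m2.
have [i0|i0] := eqVneq (val i) 0%N; last by exists (Ordinal m0).
by exists (Ordinal m2); rewrite -val_eqE /= i0.
Qed.

(** An auxiliary index j, available since m >= 2, lets the law of a pair yield the law of one value,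
    with the same normalisation [K] as the cross moments; summing out the second value gives the
    factor k - 1. *)
Lemma inj_moment_marginal (g : R -> R) i :
  K * \sum_(s : {ffun 'I_m -> 'I_k} | injectiveb s) g (e (s i))
  = N * (k%:R - 1) * \sum_a g (e a).
Proof.
have [j ij] := exists_neq_ord i.
have := sum_inj_pair (fun a _ => g (e a)) ij; rewrite card_ord => ->.
rewrite -mulrA; congr (_ * _); rewrite mulr_sumr; apply: eq_bigr => a _.
rewrite sumr_const -[LHS]mulr_natl; congr (_ * _).
by rewrite cardC1 card_ord -subn1 natrB.
Qed.

(** Since [e] sums to 0, the sum of e b over b != a is - e a. *)
Lemma inj_moment_cross i j : i != j ->
  K * \sum_(s : {ffun 'I_m -> 'I_k} | injectiveb s) e (s i) * e (s j) = - N * S.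
Proof.
move=> ij.
have := sum_inj_pair (fun a b => e a * e b) ij; rewrite card_ord => ->.
rewrite mulNr -mulrN -sumrN; congr (_ * _); apply: eq_bigr => a _.
rewrite -mulr_sumr; move: e0; rewrite (bigD1 a) //= => /eqP.
by rewrite addrC addr_eq0 => /eqP ->; rewrite mulrN expr2.
Qed.

Variable mu : 'I_m -> nat.
Let n : R := (pattern_length mu)%:R.
Let Q : R := \sum_i (mu i)%:R ^+ 2.

Lemma inj_moment_linear :
  K * \sum_(s : {ffun 'I_m -> 'I_k} | injectiveb s)
        \sum_i (mu i)%:R * e (s i) = 0.
Proof.
rewrite exchange_big mulr_sumr big1 // => i _.
by rewrite -mulr_sumr mulrCA (inj_moment_marginal id) e0 !mulr0.
Qed.

Lemma inj_moment_square :
  K * \sum_(s : {ffun 'I_m -> 'I_k} | injectiveb s)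
        \sum_i (mu i)%:R * e (s i) ^+ 2 = N * (k%:R - 1) * S * n.
Proof.
rewrite exchange_big mulr_sumr /n /pattern_length natr_sum mulr_sumr.
apply: eq_bigr => i _.
by rewrite -mulr_sumr mulrCA (inj_moment_marginal (fun x => x ^+ 2)) mulrC.
Qed.

Lemma inj_moment_linear_sqr :
  K * \sum_(s : {ffun 'I_m -> 'I_k} | injectiveb s)
        (\sum_i (mu i)%:R * e (s i)) ^+ 2 = N * S * (k%:R * Q - n ^+ 2).
Proof.
transitivity (\sum_i \sum_j (mu i)%:R * (mu j)%:R *
  (K * \sum_(s : {ffun 'I_m -> 'I_k} | injectiveb s) e (s i) * e (s j))).
  rewrite [LHS]mulr_sumr.
  under eq_bigr => s _.
    rewrite expr2 mulr_suml mulr_sumr.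
    under eq_bigr => i _ do rewrite mulr_sumr mulr_sumr.
    over.
  rewrite exchange_big; apply: eq_bigr => i _.
  rewrite exchange_big; apply: eq_bigr => j _.
  by rewrite !mulr_sumr; apply: eq_bigr => s _; ring.
(* The diagonal value N (k - 1) S is split as - N S + N k S. The first term then runs over all pairs
   and produces n^2; the second stays on the diagonal and produces k Q. *)
transitivity (\sum_i \sum_j ((mu i)%:R * (mu j)%:R * (- N * S)
  + (if i == j then (mu i)%:R * (mu j)%:R * (N * k%:R * S) else 0))).
  apply: eq_bigr => i _; apply: eq_bigr => j _.
  have [<-|ij] := eqVneq i j; last by rewrite inj_moment_cross // addr0.
  have := inj_moment_marginal (fun x => x ^+ 2) i; rewrite -/S => h.
  under eq_bigr => s _ do rewrite -expr2.
  by rewrite h; ring.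
transitivity (\sum_i ((mu i)%:R * n * (- N * S)
  + (mu i)%:R ^+ 2 * (N * k%:R * S))).
  apply: eq_bigr => i _; rewrite big_split /= -big_mkcond /= expr2.
  congr (_ + _); last by apply: big_pred1 => j; rewrite /= eq_sym.
  by rewrite /n /pattern_length natr_sum -mulr_suml -mulr_sumr.
rewrite big_split /= -!mulr_suml -natr_sum -/(pattern_length mu) -/n -/Q.
by ring.
Qed.

End InjectionMoments.

(** * Expansion of the sum over injections *)

Lemma sum_inj_prod_taylor2 (R : realType) (m k : nat) (mu : 'I_m -> nat) :
  (2 <= m)%N -> (0 < k)%N ->
  let n : R := (pattern_length mu)%:R in
  let Q : R := \sum_i (mu i)%:R ^+ 2 in
  let N : R := #|[pred s : {ffun 'I_m -> 'I_k} | injectiveb s]|%:R in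
  let D := k%:R * (Q - n) - (n ^+ 2 - n) in
  exists2 C : R, 0 <= C & forall e : 'I_k -> R, \sum_a e a = 0 ->
  let S := \sum_a e a ^+ 2 in S <= 1 ->
  `|(k * k.-1)%:R * (\sum_(s : {ffun 'I_m -> 'I_k} | injectiveb s)
         \prod_i (1 + e (s i)) ^+ mu i - N) - N * D / 2 * S|
    <= C * Num.sqrt S * S.
Proof.
move=> m2 k0 n Q N D; have [C C0 HC] := prod_1D_exp_taylor2 R mu.
(* Each of the N injections contributes an error of at most C M^3, where M = sqrt S bounds every |e
   a| and M^3 = M S. *)
pose K : R := (k * k.-1)%:R; exists (K * (N * C)).
  by rewrite !mulr_ge0 // ler0n.
move=> e e0 S S1.
have S0 : 0 <= S by apply: sumr_ge0 => a _; apply: sqr_ge0.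
set M := Num.sqrt S; have MS : M ^+ 2 = S by rewrite sqr_sqrtr.
have M01 : 0 <= M <= 1.
  by rewrite sqrtr_ge0 -[X in _ <= X]sqrtr1 ler_wsqrtr.
have eM a : `|e a| <= M.
  rewrite -sqrtr_sqr ler_wsqrtr // /S (bigD1 a) //= lerDl.
  by apply: sumr_ge0 => b _; apply: sqr_ge0.
pose A (s : {ffun 'I_m -> 'I_k}) := \sum_i (mu i)%:R * e (s i).
pose B (s : {ffun 'I_m -> 'I_k}) := \sum_i (mu i)%:R * e (s i) ^+ 2.
pose P (s : {ffun 'I_m -> 'I_k}) := \prod_i (1 + e (s i)) ^+ mu i.
pose J (f : {ffun 'I_m -> 'I_k} -> R) :=
  \sum_(s : {ffun 'I_m -> 'I_k} | injectiveb s) f s.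
have JT : J (fun s => 1 + A s + (A s ^+ 2 - B s) / 2)
    = N + J A + (J (fun s => A s ^+ 2) - J B) / 2.
  rewrite /J !big_split /= -mulr_suml big_split /= sumrN; congr (_ + _ + _).
  by rewrite sumr_const.
have -> : K * (J P - N) - N * D / 2 * S
    = K * J (fun s => P s - (1 + A s + (A s ^+ 2 - B s) / 2)).
  have -> : J (fun s => P s - (1 + A s + (A s ^+ 2 - B s) / 2))
      = J P - J (fun s => 1 + A s + (A s ^+ 2 - B s) / 2).
    by rewrite /J sumrB.
  rewrite JT.
  have KA : K * J A = 0 by exact: inj_moment_linear.
  have KB : K * J B = N * (k%:R - 1) * S * n by exact: inj_moment_square.
  have KA2 : K * J (fun s => A s ^+ 2) = N * S * (k%:R * Q - n ^+ 2).
    exact: inj_moment_linear_sqr.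
  (* The moments combine through k Q - n^2 - (k - 1) n = D. *)
  transitivity (K * J P - K * N - K * J A
    - (K * J (fun s => A s ^+ 2) - K * J B) / 2); last by field.
  by rewrite KA KB KA2 /D; field.
rewrite normrM (ger0_norm (ler0n _ _)) -!mulrA ler_wpM2l ?ler0n //.
apply: (le_trans (ler_norm_sum _ _ _)).
have -> : N * (C * (M * S)) = J (fun=> C * M ^+ 3).
  by rewrite /J sumr_const -[RHS]mulr_natl -MS; congr (_ * _); ring.
by apply: ler_sum => s _; apply: HC.
Qed.

(** * Comparison with the uniform distribution *)

Lemma pattern_prob_scale (R : realType) (m k : nat) (mu : 'I_m -> nat)
    (c : R) (x : 'I_k -> R) (p : 'rV[R]_k) :
  (forall j, p ord0 j = c * x j) ->
  pattern_prob mu p = c ^+ pattern_length mu *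
    \sum_(s : {ffun 'I_m -> 'I_k} | injectiveb s) \prod_i x (s i) ^+ mu i.
Proof.
move=> px; rewrite /pattern_prob mulr_sumr; apply: eq_bigr => s _.
rewrite /pattern_length -prodrXr -big_split /=; apply: eq_bigr => i _.
by rewrite px exprMn.
Qed.

(** The denominator is the sum of mu_i (mu_i - 1). If some mu_i exceeds 1 it is positive and the
    fraction can be cleared; otherwise D = - (n^2 - n) with n = m >= 2, and the second implication
    is vacuous. *)
Lemma Upsilon_cmp (R : realType) (m : nat) (mu : 'I_m -> nat) (x : R) :
  (2 <= m)%N -> (forall i, (0 < mu i)%N) ->
  let n : R := (pattern_length mu)%:R in
  let D := x * (\sum_i (mu i)%:R ^+ 2 - n) - (n ^+ 2 - n) in
  ((x%:E < Upsilon R mu)%E -> D < 0) /\ ((Upsilon R mu < x%:E)%E -> 0 < D).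
Proof.
move=> m2 mu0 n D; rewrite /Upsilon -/n.
have QnE : \sum_i (mu i)%:R ^+ 2 - n = \sum_i (mu i * (mu i).-1)%:R :> R.
  rewrite /n /pattern_length natr_sum -sumrB; apply: eq_bigr => i _.
  by rewrite natrM -subn1 natrB // mulrBr mulr1 expr2.
case: ifPn => [/forallP mu1|/forallPn[i mui]].
  split=> [_|]; last by rewrite ltNge leey.
  rewrite /D QnE big1 => [|i _]; last by rewrite (eqP (mu1 i)).
  have nm : n = m%:R.
    rewrite /n /pattern_length; under eq_bigr => i _ do rewrite (eqP (mu1 i)).
    by rewrite sum1_card card_ord.
  have : 2 <= n by rewrite nm ler_nat.
  by move=> n2; nra.
have Qn0 : 0 < \sum_i (mu i)%:R ^+ 2 - n.
  rewrite QnE (bigD1 i) //= ltr_wpDr ?sumr_ge0 //.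
  by rewrite ltr0n muln_gt0 mu0 /=; case: (mu i) (mu0 i) mui => [|[]].
by rewrite !lte_fin ltr_pdivlMr // ltr_pdivrMr // /D subr_lt0 subr_gt0.
Qed.

Lemma near_uniform_sqr_dev (R : realType) (k : nat) (eps : R) :
  (0 < k)%N -> 0 < eps ->
  nbhs (uniform_distr R k)
    [set p | \sum_j (k%:R * p ord0 j - 1) ^+ 2 <= eps].
Proof.
move=> k0 eps0; have kR : 0 < k%:R :> R by rewrite ltr0n.
have f0 : \sum_j (k%:R * uniform_distr R k ord0 j - 1) ^+ 2 = 0.
  apply: big1 => j _; rewrite mxE divff ?gt_eqF // subrr expr0n //.
pose f (p : 'rV[R]_k) := \sum_j (k%:R * p ord0 j - 1) ^+ 2.
have cf : continuous f.
  apply: (continuous_big (@add_continuous R)) => j _ p.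
  have c1 : (fun q : 'rV[R]_k => q ord0 j) @ p --> (p : 'rV[R]_k) ord0 j.
    exact: coord_continuous.
  have c2 := cvgB (cvgMl_tmp (a := k%:R) c1) (cvg_cst (1 : R)).
  exact: (cvgM (c2 _ _ _) (c2 _ _ _)).
apply: (cvgr_le _ (cf (uniform_distr R k))).
by rewrite /f f0.
Qed.

(** Multiplying the increment by [D] treats the maximum and the minimum at once. *)
Lemma pattern_prob_near_uniform (R : realType) (m k : nat) (mu : 'I_m -> nat) :
  (2 <= m)%N -> (m <= k)%N ->
  let n : R := (pattern_length mu)%:R in
  let D := k%:R * (\sum_i (mu i)%:R ^+ 2 - n) - (n ^+ 2 - n) in
  D != 0 ->
  \forall p \near within (@simplex R k) (nbhs (uniform_distr R k)),
    0 <= (pattern_prob mu p - pattern_prob mu (uniform_distr R k)) * D.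
Proof.
move=> m2 mk n D D0.
have k0 : (0 < k)%N by apply: leq_trans mk; apply: leq_trans m2.
have kR : k%:R != 0 :> R by rewrite pnatr_eq0 -lt0n.
have [C C0 HC] := sum_inj_prod_taylor2 R mu m2 k0.
move: HC; rewrite -/n -/D; set N : R := (X in X * D); set K : R := (_ * _)%:R => HC.
have K0 : 0 < K.
  rewrite ltr0n muln_gt0 k0 /= -ltnS prednK //.
  exact: leq_trans mk.
have N0 : 0 < N.
  rewrite ltr0n; apply/card_gt0P; exists [ffun i => widen_ord mk i].
  rewrite inE; apply/injectiveP => i j; rewrite !ffunE => /(congr1 val) /=.
  exact: val_inj.
(* Chosen so that (C + 1) eps = N |D| / 2: once sqrt S <= eps, the remainder does not exceed the
   main term. Using C + 1 keeps the denominator positive when C = 0. *)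
pose eps := N * `|D| / (2 * (C + 1)).
have C1 : 0 < C + 1 by rewrite ltr_wpDl.
have eps0 : 0 < eps by rewrite divr_gt0 ?mulr_gt0 ?normr_gt0.
rewrite near_withinE; near=> p.
have S1 : \sum_j (k%:R * p ord0 j - 1) ^+ 2 <= 1.
  by near: p; apply: near_uniform_sqr_dev.
have Seps : \sum_j (k%:R * p ord0 j - 1) ^+ 2 <= eps ^+ 2.
  by near: p; apply: near_uniform_sqr_dev => //; rewrite exprn_gt0.
move=> [p0 p1].
pose e j := k%:R * p ord0 j - 1.
have e0 : \sum_j e j = 0.
  by rewrite sumrB -mulr_sumr p1 sumr_const card_ord mulr1 subrr.
pose S := \sum_j e j ^+ 2; rewrite -/S in S1 Seps.
have S0 : 0 <= S by apply: sumr_ge0 => j _; apply: sqr_ge0.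
have sqS : Num.sqrt S <= eps.
  by rewrite -(ger0_norm (ltW eps0)) -sqrtr_sqr ler_wsqrtr.
have CS : C * Num.sqrt S <= N * `|D| / 2.
  apply: (@le_trans _ _ ((C + 1) * eps)).
    by rewrite ler_pM ?sqrtr_ge0 // lerDl.
  by rewrite /eps le_eqVlt; apply/orP; left; apply/eqP; field; rewrite gt_eqF.
rewrite (@pattern_prob_scale _ _ _ _ k%:R^-1 (fun j => 1 + e j)); last first.
  by move=> j; rewrite /e addrC subrK mulKf.
rewrite (@pattern_prob_scale _ _ _ _ k%:R^-1 (fun=> 1)) => [|j]; last first.
  by rewrite mxE mulr1.
have -> : \sum_(s : {ffun 'I_m -> 'I_k} | injectiveb s)
    \prod_i (1 : R) ^+ mu i = N.
  rewrite /N -sumr_const; apply: eq_bigr => s _.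
  by apply: big1 => i _; rewrite expr1n.
rewrite -mulrBr -mulrA mulr_ge0 ?exprn_ge0 ?invr_ge0 ?ler0n //.
have := HC e e0 S1; rewrite -/S.
set W := \sum_(s | _) _ => WN.
(* This confines K (W - N) to the interval between 0 and N D S, so it cannot have the sign opposite
   to [D]. *)
have : `|K * (W - N) - N * D / 2 * S| <= N * `|D| / 2 * S.
  by apply: le_trans WN _; rewrite ler_wpM2r.
rewrite -(pmulr_rge0 _ K0) mulrA; set V := K * (W - N).
rewrite ler_norml => /andP[h1 h2].
have [Dp|Dn|D00] := ltrgtP 0 D; last by rewrite -D00 eqxx in D0.
- rewrite gtr0_norm // in h1 h2.
  by rewrite mulr_ge0 ?(ltW Dp) //; lra.
- rewrite ltr0_norm // in h1 h2.
  by rewrite mulr_le0 ?(ltW Dn) //; lra.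
Unshelve. all: by end_near. Qed.

Theorem theorem1 (R : realType) (m : nat) (hm : (2 <= m)%N)
    (mu : 'I_m -> nat) (hmu : forall i, (0 < mu i)%N)
    (k : nat) (hk : (m <= k)%N) :
  ((k%:R%:E < Upsilon R mu)%E ->
     local_max_on (@simplex R k) (pattern_prob mu) (uniform_distr R k)) /\
  ((Upsilon R mu < k%:R%:E)%E ->
     local_min_on (@simplex R k) (pattern_prob mu) (uniform_distr R k)).
Proof.
have k0 : (0 < k)%N by apply: leq_trans hk; apply: leq_trans hm.
have US : simplex (uniform_distr R k).
  split=> [j|]; first by rewrite mxE invr_ge0 ler0n.
  under eq_bigr do rewrite mxE.
  by rewrite sumr_const card_ord -[LHS]mulr_natl divff // pnatr_eq0 -lt0n.
have [Hlt Hgt] := Upsilon_cmp (k%:R : R) hm hmu.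
split=> [/Hlt|/Hgt] D0; split=> //.
- have := pattern_prob_near_uniform hm hk (ltr0_neq0 D0).
  by apply: filterS => p; rewrite nmulr_lge0 // subr_le0.
- have := pattern_prob_near_uniform hm hk (lt0r_neq0 D0).
  by apply: filterS => p; rewrite pmulr_lge0 // subr_ge0.
Qed.
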